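(* A non-Abelian three-dimensional complex Lie algebra admits a Nijenhuis eigenbasis if and only if it is isomorphic to one of $\mathfrak b_{3,3}$, $\mathfrak b_{3,4}$, or $\mathfrak b_{3,6}$ (the latter for some value of its parameter $a\in\mathbb C$), where these are the complex Lie algebras with basis $\eta_1,\eta_2,\eta_3$ and the following non-zero brackets: - $\mathfrak b_{3,3}$: $[\eta_1,\eta_2]=\eta_3$, $[\eta_2,\eta_3]=\eta_1$, $[\eta_3,\eta_1]=\eta_2$; - $\mathfrak b_{3,4}$: $[\eta_1,\eta_2]=\eta_2$, $[\eta_3,\eta_1]=-\eta_3$; - $\mathfrak b_{3,6}$ (with arbitrary $a\in\mathbb C$): $[\eta_1,\eta_2]=a\eta_2+\eta_3$, $[\eta_3,\eta_1]=\eta_2-a\eta_3$.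
   Context: A Nijenhuis eigenbasis of a finite-dimensional Lie algebra $\mathfrak g$ is a basis $\zeta_1,\dots,\zeta_n$ of $\mathfrak g$ such that $[\zeta_i,\zeta_j]$ lies in the linear span of $\zeta_i$ and $\zeta_j$ for all $i,j$. The well-known classification says that every three-dimensional complex Lie algebra is isomorphic to one of the following, given by a basis $\eta_1,\eta_2,\eta_3$ and the non-zero brackets: $\mathfrak b_{3,1}$: Abelian; $\mathfrak b_{3,2}$: $[\eta_2,\eta_3]=\eta_1$; $\mathfrak b_{3,3}$: $[\eta_1,\eta_2]=\eta_3$, $[\eta_2,\eta_3]=\eta_1$, $[\eta_3,\eta_1]=\eta_2$; $\mathfrak b_{3,4}$: $[\eta_1,\eta_2]=\eta_2$, $[\eta_3,\eta_1]=-\eta_3$; $\mathfrak b_{3,5}$: $[\eta_1,\eta_2]=\eta_2+\eta_3$, $[\eta_3,\eta_1]=-\eta_3$; $\mathfrak b_{3,6}$: $[\eta_1,\eta_2]=a\eta_2+\eta_3$, $[\eta_3,\eta_1]=\eta_2-a\eta_3$, $a\in\mathbb C$. *)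

(* Defs.v *)
From HB Require Import structures.
From mathcomp Require Import all_boot all_order all_algebra.
From mathcomp Require Import ring.

Set Implicit Arguments.
Unset Strict Implicit.
Unset Printing Implicit Defensive.

Import GRing.Theory.
Local Open Scope ring_scope.

HB.mixin Record Lmodule_isLieAlgebra (K : fieldType) V of GRing.Lmodule K V := {
  lie : V -> V -> V;
  lie_linearl : forall y : V, linear (fun x => lie x y);
  lie_linearr : forall x : V, linear (lie x);
  lie_alternating : forall x : V, lie x x = 0;
  lie_jacobi : forall x y z : V,
    lie x (lie y z) + lie y (lie z x) + lie z (lie x y) = 0
}.

#[short(type="lieAlgType")]
HB.structure Definition LieAlgebra (K : fieldType) :=
  {V of GRing.Lmodule K V & Lmodule_isLieAlgebra K V}.

#[short(type="finLieAlgType")]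
HB.structure Definition FinLieAlgebra (K : fieldType) :=
  {V of Vector K V & Lmodule_isLieAlgebra K V}.

Definition lie_abelian (K : fieldType) (g : lieAlgType K) : Prop :=
  forall x y : g, lie x y = 0.

Definition lie_isog (K : fieldType) (g h : lieAlgType K) : Prop :=
  exists f : {linear g -> h},
    bijective f /\ {morph f : x y / lie x y >-> lie x y}.

Definition nijenhuis_eigenbasis (K : fieldType) (g : finLieAlgType K)
    (Z : seq g) : Prop :=
  basis_of fullv Z /\ {in Z &, forall x y, lie x y \in <<[:: x; y]>>%VS}.

Section Models.
Variable K : fieldType.

Definition eta1 : 'rV[K]_3 := delta_mx 0 0.
Definition eta2 : 'rV[K]_3 := delta_mx 0 1.
Definition eta3 : 'rV[K]_3 := delta_mx 0 2.

(* The alternating bilinear map on K^3 determined by its values c12, c23, c31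
   at (eta1, eta2), (eta2, eta3), (eta3, eta1).  The column indices 0, 1, 2
   are elements of the ring 'I_3. *)
Definition bracket3 (c12 c23 c31 x y : 'rV[K]_3) : 'rV[K]_3 :=
  (x 0 0 * y 0 1 - x 0 1 * y 0 0) *: c12
  + (x 0 1 * y 0 2 - x 0 2 * y 0 1) *: c23
  + (x 0 2 * y 0 0 - x 0 0 * y 0 2) *: c31.

Lemma bracket3_eta c12 c23 c31 (b := bracket3 c12 c23 c31) :
  [/\ b eta1 eta2 = c12, b eta2 eta3 = c23 & b eta3 eta1 = c31].
Proof.
by split; apply/rowP => j; rewrite /b /bracket3 /eta1 /eta2 /eta3 !mxE
  -!val_eqE /=; ring.
Qed.

Lemma bracket3_linearl c12 c23 c31 y :
  linear (fun x => bracket3 c12 c23 c31 x y).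
Proof. by move=> a u v; apply/rowP => j; rewrite /bracket3 !mxE; ring. Qed.

Lemma bracket3_linearr c12 c23 c31 x : linear (bracket3 c12 c23 c31 x).
Proof. by move=> a u v; apply/rowP => j; rewrite /bracket3 !mxE; ring. Qed.

Lemma bracket3_alternating c12 c23 c31 x : bracket3 c12 c23 c31 x x = 0.
Proof. by apply/rowP => j; rewrite /bracket3 !mxE; ring. Qed.

(* Each model is its own alias of K^3, so that each carries its own bracket;
   b36 a depends on a for the same reason. *)
Definition b33 : Type := 'rV[K]_3.
HB.instance Definition _ := Vector.on b33.

Definition b33_lie : b33 -> b33 -> b33 := bracket3 eta3 eta1 eta2.

Lemma b33_jacobi (x y z : b33) :
  b33_lie x (b33_lie y z) + b33_lie y (b33_lie z x) + b33_lie z (b33_lie x y)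
  = 0.
Proof.
apply/rowP => j.
rewrite /b33_lie /bracket3 /eta1 /eta2 /eta3 !mxE -!val_eqE /=; ring.
Qed.

HB.instance Definition _ := Lmodule_isLieAlgebra.Build K b33
  (bracket3_linearl eta3 eta1 eta2) (bracket3_linearr eta3 eta1 eta2)
  (bracket3_alternating eta3 eta1 eta2) b33_jacobi.

Lemma b33_lieE (e1 e2 e3 : b33) :
  e1 = eta1 -> e2 = eta2 -> e3 = eta3 ->
  [/\ lie e1 e2 = e3, lie e2 e3 = e1 & lie e3 e1 = e2].
Proof. by move=> -> -> ->; exact: bracket3_eta. Qed.

Definition b34 : Type := 'rV[K]_3.
HB.instance Definition _ := Vector.on b34.

Definition b34_lie : b34 -> b34 -> b34 := bracket3 eta2 0 (- eta3).

Lemma b34_jacobi (x y z : b34) :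
  b34_lie x (b34_lie y z) + b34_lie y (b34_lie z x) + b34_lie z (b34_lie x y)
  = 0.
Proof.
apply/rowP => j.
rewrite /b34_lie /bracket3 /eta1 /eta2 /eta3 !mxE -!val_eqE /=; ring.
Qed.

HB.instance Definition _ := Lmodule_isLieAlgebra.Build K b34
  (bracket3_linearl eta2 0 (- eta3)) (bracket3_linearr eta2 0 (- eta3))
  (bracket3_alternating eta2 0 (- eta3)) b34_jacobi.

Lemma b34_lieE (e1 e2 e3 : b34) :
  e1 = eta1 -> e2 = eta2 -> e3 = eta3 ->
  [/\ lie e1 e2 = e2, lie e2 e3 = 0 & lie e3 e1 = - e3].
Proof. by move=> -> -> ->; exact: bracket3_eta. Qed.

Definition b36 (a : K) : Type := 'rV[K]_3.
HB.instance Definition _ (a : K) := Vector.on (b36 a).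

Definition b36_lie (a : K) : b36 a -> b36 a -> b36 a :=
  bracket3 (a *: eta2 + eta3) 0 (eta2 - a *: eta3).

Lemma b36_jacobi (a : K) (x y z : b36 a) :
  b36_lie x (b36_lie y z) + b36_lie y (b36_lie z x) + b36_lie z (b36_lie x y)
  = 0.
Proof.
apply/rowP => j.
rewrite /b36_lie /bracket3 /eta1 /eta2 /eta3 !mxE -!val_eqE /=; ring.
Qed.

HB.instance Definition _ (a : K) := Lmodule_isLieAlgebra.Build K (b36 a)
  (bracket3_linearl (a *: eta2 + eta3) 0 (eta2 - a *: eta3))
  (bracket3_linearr (a *: eta2 + eta3) 0 (eta2 - a *: eta3))
  (bracket3_alternating (a *: eta2 + eta3) 0 (eta2 - a *: eta3))
  (@b36_jacobi a).

Lemma b36_lieE (a : K) (e1 e2 e3 : b36 a) :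
  e1 = eta1 -> e2 = eta2 -> e3 = eta3 ->
  [/\ lie e1 e2 = a *: e2 + e3, lie e2 e3 = 0 & lie e3 e1 = e2 - a *: e3].
Proof. by move=> -> -> ->; exact: bracket3_eta. Qed.

End Models.

(* Main.v *)
Require Import Defs.
From HB Require Import structures.
From mathcomp Require Import all_boot all_order all_algebra.
From mathcomp Require Import ring.
From mathcomp Require Import reals complex.

(** Let [x1; x2; x3] be a Nijenhuis eigenbasis with
    [x1, x2] = al x1 + be x2, [x2, x3] = p x2 + q x3, [x3, x1] = s x1 + r x3.
    The Jacobi identity amounts to p al = q s, r p = s be and al r = be q.
    If g is not abelian, then after a cyclic permutation be or r is nonzero.
    Since ad x1 has eigenvalues 0, be and - r, either x1 together with two
    commuting eigenvectors of ad x1 forms a basis, which gives b34 when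
    be = - r and b36 otherwise, or the Jacobi relations force al = q, be = r
    and p = s with all three nonzero.  In the latter case g is isomorphic to
    so_3 = (C^3, cross product), where the vectors z1 = (i, 0, 0),
    z2 = (-i, i, -1), z3 = (-i, -i, -1) satisfy z_j x z_k = z_j + z_k for
    (j, k) = (1, 2), (2, 3), (3, 1), so that be z1, q z2, p z3 have the required
    brackets.  The same bases of the models give the converse. *)

Set Implicit Arguments.
Unset Strict Implicit.
Unset Printing Implicit Defensive.

Import GRing.Theory.
Local Open Scope ring_scope.

(** * Coordinates with respect to three vectors *)

Definition lc3 (K : fieldType) (V : lmodType K) (x1 x2 x3 : V)
    (c : K * K * K) : V :=
  c.1.1 *: x1 + c.1.2 *: x2 + c.2 *: x3.

Section LinearCombinations.
Variables (K : fieldType) (V : vectType K).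
Implicit Types (x y : V) (d : K).

Lemma lc3D x1 x2 x3 a1 a2 a3 b1 b2 b3 :
  lc3 x1 x2 x3 (a1, a2, a3) + lc3 x1 x2 x3 (b1, b2, b3) =
  lc3 x1 x2 x3 (a1 + b1, a2 + b2, a3 + b3).
Proof. by rewrite /lc3 /= !scalerDl addrACA -(addrACA (a1 *: _)). Qed.

Lemma lc3Z x1 x2 x3 c a1 a2 a3 :
  c *: lc3 x1 x2 x3 (a1, a2, a3) = lc3 x1 x2 x3 (c * a1, c * a2, c * a3).
Proof. by rewrite /lc3 /= !scalerDr !scalerA. Qed.

Lemma lc3_1 x1 x2 x3 : x1 = lc3 x1 x2 x3 (1, 0, 0).
Proof. by rewrite /lc3 /= scale1r !scale0r !addr0. Qed.

Lemma lc3_2 x1 x2 x3 : x2 = lc3 x1 x2 x3 (0, 1, 0).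
Proof. by rewrite /lc3 /= scale1r !scale0r add0r addr0. Qed.

Lemma lc3_3 x1 x2 x3 : x3 = lc3 x1 x2 x3 (0, 0, 1).
Proof. by rewrite /lc3 /= scale1r !scale0r !add0r. Qed.

Lemma lc3_0 x1 x2 x3 : 0 = lc3 x1 x2 x3 (0, 0, 0).
Proof. by rewrite /lc3 /= !scale0r !addr0. Qed.

Lemma linear_lc3 (U : lmodType K) (f : {linear V -> U}) x1 x2 x3 c :
  f (lc3 x1 x2 x3 c) = lc3 (f x1) (f x2) (f x3) c.
Proof. by rewrite /lc3 !raddfD /= !linearZ_LR. Qed.

Definition coord3 x1 x2 x3 v : K * K * K :=
  let X := [tuple x1; x2; x3] in
  (coord X 0 v, coord X 1 v, coord X 2%R v).

Lemma lc3_sum x1 x2 x3 (k : 'I_3 -> K) :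
  lc3 x1 x2 x3 (k 0, k 1, k 2%R) = \sum_i k i *: [tuple x1; x2; x3]`_i.
Proof.
rewrite !big_ord_recl big_ord0 addr0 addrA /lc3 /=.
(* The indices of the unfolded sum are lifts of [ord0]; they are compared with the ring constants of
   ['I_3] by value. *)
by congr (k _ *: _ + k _ *: _ + k _ *: _); apply/val_inj.
Qed.

Lemma coord3K x1 x2 x3 v : basis_of fullv [:: x1; x2; x3] ->
  lc3 x1 x2 x3 (coord3 x1 x2 x3 v) = v.
Proof.
move=> bX; rewrite (lc3_sum x1 x2 x3 (fun i => coord [tuple x1; x2; x3] i v)).
by rewrite -(coord_basis (X := [tuple x1; x2; x3]) bX) ?memvf.
Qed.

Lemma lc3K x1 x2 x3 c : basis_of fullv [:: x1; x2; x3] ->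
  coord3 x1 x2 x3 (lc3 x1 x2 x3 c) = c.
Proof.
case: c => [[a b] e] bX.
pose k (i : 'I_3) := nth 0 [:: a; b; e] i.
have -> : (a, b, e) = (k 0, k 1, k 2%R) by [].
by rewrite lc3_sum /coord3 !coord_sum_free // ?(basis_free bX).
Qed.

Lemma lc3_inj x1 x2 x3 : basis_of fullv [:: x1; x2; x3] ->
  injective (lc3 x1 x2 x3).
Proof. by move=> bX c d e; rewrite -(lc3K c bX) e lc3K. Qed.

(** The [y]s span a nonzero multiple of every vector of a basis, hence everything, and three
    spanning vectors are a basis by dimension. With [d] a determinant, the coefficients are
    cofactors and no division occurs. *)
Lemma basis_of_scaled_lc3 x1 x2 x3 y1 y2 y3 d c1 c2 c3 :
    basis_of fullv [:: x1; x2; x3] -> d != 0 ->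
    d *: x1 = lc3 y1 y2 y3 c1 -> d *: x2 = lc3 y1 y2 y3 c2 ->
    d *: x3 = lc3 y1 y2 y3 c3 ->
  basis_of fullv [:: y1; y2; y3].
Proof.
move=> bX d0 e1 e2 e3.
rewrite basisEdim (size_basis (X := [tuple x1; x2; x3]) bX) leqnn andbT.
have mem x c : d *: x = lc3 y1 y2 y3 c -> x \in <<[:: y1; y2; y3]>>%VS.
  move=> e; rewrite -(scale1r x) -(mulVf d0) -scalerA e memvZ //.
  by rewrite !memvD // memvZ // memv_span // !inE eqxx ?orbT.
rewrite -(span_basis bX); apply/span_subvP => x.
by rewrite !inE => /or3P[] /eqP ->; [exact: mem e1|exact: mem e2|exact: mem e3].
Qed.

End LinearCombinations.

(** * Consequences of bilinearity and alternation *)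

Section LieBracket.
Variables (K : fieldType) (g : lieAlgType K).
Implicit Types (x y z : g).

Lemma lieDl x y z : lie (x + y) z = lie x z + lie y z.
Proof. by have := lie_linearl z 1 x y; rewrite !scale1r. Qed.

Lemma lieDr x y z : lie x (y + z) = lie x y + lie x z.
Proof. by have := lie_linearr x 1 y z; rewrite !scale1r. Qed.

Lemma lie0l z : lie (0 : g) z = 0.
Proof. by apply: (addrI (lie 0 z)); rewrite -lieDl !addr0. Qed.

Lemma lie0r z : lie z (0 : g) = 0.
Proof. by apply: (addrI (lie z 0)); rewrite -lieDr !addr0. Qed.

Lemma lieZl a x z : lie (a *: x) z = a *: lie x z.
Proof. by have := lie_linearl z a x 0; rewrite lie0l !addr0. Qed.

Lemma lieZr a x z : lie z (a *: x) = a *: lie z x.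
Proof. by have := lie_linearr z a x 0; rewrite lie0r !addr0. Qed.

Lemma lieC x y : lie x y = - lie y x.
Proof.
apply/eqP; rewrite -addr_eq0; apply/eqP.
have := lie_alternating (x + y).
by rewrite lieDl !lieDr !lie_alternating add0r addr0.
Qed.

Lemma lie_lc3 x1 x2 x3 a b :
  lie (lc3 x1 x2 x3 a) (lc3 x1 x2 x3 b) =
  lc3 (lie x1 x2) (lie x2 x3) (lie x3 x1)
    (a.1.1 * b.1.2 - a.1.2 * b.1.1, a.1.2 * b.2 - a.2 * b.1.2,
     a.2 * b.1.1 - a.1.1 * b.2).
Proof.
rewrite /lc3 !(lieDl, lieDr, lieZl, lieZr) !lie_alternating !scaler0.
rewrite (lieC x2 x1) (lieC x3 x2) (lieC x1 x3) !scalerN !scalerA.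
rewrite !scalerBl add0r addr0 /= addr0.
by rewrite (+%R.[AC (2 * 2 * 2) ((1 * 3) * (4 * 6) * (5 * 2))]).
Qed.

End LieBracket.

(** * Structure constants, isomorphisms and transport of eigenbases *)

Definition lie_table (K : fieldType) (g : finLieAlgType K) (x1 x2 x3 : g)
    (c12 c23 c31 : K * K * K) : Prop :=
  [/\ basis_of fullv [:: x1; x2; x3],
      lie x1 x2 = lc3 x1 x2 x3 c12,
      lie x2 x3 = lc3 x1 x2 x3 c23 &
      lie x3 x1 = lc3 x1 x2 x3 c31].

Section Isomorphism.
Variable K : fieldType.
Implicit Types g h : finLieAlgType K.

Definition change_basis g h (x1 x2 x3 : g) (y1 y2 y3 : h) (v : g) : h :=
  lc3 y1 y2 y3 (coord3 x1 x2 x3 v).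

Lemma change_basis_linear g h (x1 x2 x3 : g) (y1 y2 y3 : h) :
  linear (change_basis x1 x2 x3 y1 y2 y3).
Proof. by move=> a u v; rewrite /change_basis /coord3 !linearP lc3Z lc3D. Qed.

(** Matching coordinates in the two bases is a linear bijection. It respects brackets because both
    are the same bilinear expression in the coordinates. *)
Lemma lie_isog_table g h (x1 x2 x3 : g) (y1 y2 y3 : h) c12 c23 c31 :
  lie_table x1 x2 x3 c12 c23 c31 -> lie_table y1 y2 y3 c12 c23 c31 ->
  lie_isog g h.
Proof.
case=> bX x12 x23 x31 [bY y12 y23 y31].
pose f := change_basis x1 x2 x3 y1 y2 y3.
pose L := GRing.isLinear.Build K g h _ f (change_basis_linear x1 x2 x3 y1 y2 y3).
pose F : {linear g -> h} := HB.pack f L.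
have FE c : F (lc3 x1 x2 x3 c) = lc3 y1 y2 y3 c.
  by rewrite /= /f /change_basis lc3K.
exists F; split.
  exists (change_basis y1 y2 y3 x1 x2 x3) => v.
    by rewrite -[v in LHS](coord3K v bX) FE /change_basis lc3K // coord3K.
  by rewrite {1}/change_basis FE coord3K.
move=> u v; rewrite -(coord3K u bX) -(coord3K v bX).
by rewrite !FE !lie_lc3 x12 x23 x31 y12 y23 y31 linear_lc3 !FE.
Qed.

Lemma nijenhuis_eigenbasis_isog g h (Z : seq h) :
  lie_isog g h -> nijenhuis_eigenbasis Z ->
  exists Z' : seq g, nijenhuis_eigenbasis Z'.
Proof.
case=> F [[G FK GK] Flie] [bZ nZ].
have F0 : lker (linfun F) == 0%VS.
  by apply/lker0P => x y; rewrite !lfunE; exact: (can_inj FK).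
have FT : (linfun F @: fullv)%VS = fullv.
  apply/vspaceP => z; rewrite memvf -[z]GK -(lfunE F).
  by rewrite memv_img ?memvf.
have mapF (X : seq g) : map F X = map (linfun F) X.
  by apply: eq_map => x; rewrite lfunE.
(* Injectivity of [F] allows span membership to be tested in [h], where the eigenbasis is given. *)
have memF (X : seq g) x : F x \in <<map F X>>%VS -> x \in <<X>>%VS.
  by rewrite !memvE mapF -limg_span -(lfunE F) -limg_line limg_ker0.
have eZ : map F (map G Z) = Z.
  by rewrite -map_comp map_id_in // => z _ /=; exact: GK.
exists (map G Z); split.
  rewrite basisEdim; apply/andP; split.
    by apply/subvP => x _; apply: memF; rewrite eZ (span_basis bZ) memvf.
  rewrite size_map -(limg_dim_eq (f := linfun F)) ?(eqP F0) ?capv0 // FT.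
  by case/andP: bZ => /eqP <- /eqP ->.
move=> x y /mapP[z zZ ->] /mapP[w wZ ->].
by apply: memF; rewrite Flie /= !GK; exact: nZ.
Qed.

End Isomorphism.

(** * Changes of basis and reduction to normal forms *)

Section Tables.
Variable K : fieldType.
Implicit Types (g : finLieAlgType K) (u v w : K * K * K).

(** These are the coordinates of the exterior product of [a] and [b] in the cyclic order 12, 23, 31;
    the bracket depends linearly on them. *)
Definition minors (a b : K * K * K) : K * K * K :=
  (a.1.1 * b.1.2 - a.1.2 * b.1.1, a.1.2 * b.2 - a.2 * b.1.2,
   a.2 * b.1.1 - a.1.1 * b.2).

Definition vec3 u v w c : K * K * K :=
  (c.1.1 * u.1.1 + c.1.2 * v.1.1 + c.2 * w.1.1,
   c.1.1 * u.1.2 + c.1.2 * v.1.2 + c.2 * w.1.2,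
   c.1.1 * u.2 + c.1.2 * v.2 + c.2 * w.2).

Definition det3 u v w : K :=
  u.1.1 * (v.1.2 * w.2 - v.2 * w.1.2) - u.1.2 * (v.1.1 * w.2 - v.2 * w.1.1)
  + u.2 * (v.1.1 * w.1.2 - v.1.2 * w.1.1).

Lemma lc3_lc3 (V : vectType K) (x1 x2 x3 : V) u v w c :
  lc3 (lc3 x1 x2 x3 u) (lc3 x1 x2 x3 v) (lc3 x1 x2 x3 w) c =
  lc3 x1 x2 x3 (vec3 u v w c).
Proof.
case: u v w => [[u1 u2] u3] [[v1 v2] v3] [[w1 w2] w3].
by rewrite [LHS]/lc3 !lc3Z !lc3D.
Qed.

Lemma lie_table_lc3 g (x1 x2 x3 : g) c12 c23 c31 a b :
  lie_table x1 x2 x3 c12 c23 c31 ->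
  lie (lc3 x1 x2 x3 a) (lc3 x1 x2 x3 b) =
  lc3 x1 x2 x3 (vec3 c12 c23 c31 (minors a b)).
Proof. by case=> _ e12 e23 e31; rewrite lie_lc3 e12 e23 e31 lc3_lc3. Qed.

(** This reduces a change of basis to a nonvanishing determinant and scalar identities, which [ring]
    settles, if necessary modulo the Jacobi relations or [i * i = -1]. *)
Lemma lie_table_change g (x1 x2 x3 : g) c12 c23 c31 m1 m2 m3 d12 d23 d31 :
    lie_table x1 x2 x3 c12 c23 c31 -> det3 m1 m2 m3 != 0 ->
    vec3 c12 c23 c31 (minors m1 m2) = vec3 m1 m2 m3 d12 ->
    vec3 c12 c23 c31 (minors m2 m3) = vec3 m1 m2 m3 d23 ->
    vec3 c12 c23 c31 (minors m3 m1) = vec3 m1 m2 m3 d31 ->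
  lie_table (lc3 x1 x2 x3 m1) (lc3 x1 x2 x3 m2) (lc3 x1 x2 x3 m3) d12 d23 d31.
Proof.
move=> T d0 e12 e23 e31.
split; rewrite ?lc3_lc3 -?e12 -?e23 -?e31; try exact: lie_table_lc3.
case: T => bX _ _ _.
(* The coordinates of [det3 m1 m2 m3 *: x_j] are given by the adjugate. *)
pose x (i j k l : K) : K := i * l - j * k.
pose r1 := (x m2.1.2 m2.2 m3.1.2 m3.2, x m3.1.2 m3.2 m1.1.2 m1.2,
  x m1.1.2 m1.2 m2.1.2 m2.2).
pose r2 := (x m2.2 m2.1.1 m3.2 m3.1.1, x m3.2 m3.1.1 m1.2 m1.1.1,
  x m1.2 m1.1.1 m2.2 m2.1.1).
pose r3 := (x m2.1.1 m2.1.2 m3.1.1 m3.1.2, x m3.1.1 m3.1.2 m1.1.1 m1.1.2,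
  x m1.1.1 m1.1.2 m2.1.1 m2.1.2).
have h1 : det3 m1 m2 m3 *: x1 =
    lc3 (lc3 x1 x2 x3 m1) (lc3 x1 x2 x3 m2) (lc3 x1 x2 x3 m3) r1.
  rewrite lc3_lc3 [X in _ *: X](lc3_1 x1 x2 x3) lc3Z; congr lc3.
  by rewrite /vec3 /det3 /r1 /x /=; congr (_, _, _); ring.
have h2 : det3 m1 m2 m3 *: x2 =
    lc3 (lc3 x1 x2 x3 m1) (lc3 x1 x2 x3 m2) (lc3 x1 x2 x3 m3) r2.
  rewrite lc3_lc3 [X in _ *: X](lc3_2 x1 x2 x3) lc3Z; congr lc3.
  by rewrite /vec3 /det3 /r2 /x /=; congr (_, _, _); ring.
have h3 : det3 m1 m2 m3 *: x3 =
    lc3 (lc3 x1 x2 x3 m1) (lc3 x1 x2 x3 m2) (lc3 x1 x2 x3 m3) r3.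
  rewrite lc3_lc3 [X in _ *: X](lc3_3 x1 x2 x3) lc3Z; congr lc3.
  by rewrite /vec3 /det3 /r3 /x /=; congr (_, _, _); ring.
exact: basis_of_scaled_lc3 bX d0 h1 h2 h3.
Qed.

Lemma nijenhuis_eigenbasis_table g (x1 x2 x3 : g) al be p q r s :
  lie_table x1 x2 x3 (al, be, 0) (0, p, q) (s, 0, r) ->
  nijenhuis_eigenbasis [:: x1; x2; x3].
Proof.
case=> bX; rewrite /lc3 /= !scale0r !addr0 add0r => e12 e23 e31; split=> //.
have mem (x y : g) a b : a *: x + b *: y \in <<[:: x; y]>>%VS.
  by rewrite memvD // memvZ // memv_span // !inE eqxx ?orbT.
move=> x y; rewrite !inE => /or3P[]/eqP-> /or3P[]/eqP->;
  rewrite ?lie_alternating ?mem0v //.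
- by rewrite e12 mem.
- by rewrite lieC e31 memvN mem.
- by rewrite lieC e12 memvN addrC mem.
- by rewrite e23 mem.
- by rewrite e31 addrC mem.
- by rewrite lieC e23 memvN addrC mem.
Qed.

Lemma table_nijenhuis_eigenbasis g (Z : seq g) :
  \dim (@fullv _ g) = 3%N -> nijenhuis_eigenbasis Z ->
  exists x1 x2 x3 : g, exists al be p q r s,
    lie_table x1 x2 x3 (al, be, 0) (0, p, q) (s, 0, r).
Proof.
move=> dim3 [bZ nZ].
have sZ : size Z = 3%N.
  by rewrite -dim3 -(span_basis bZ); apply/esym/eqP; exact: basis_free bZ.
case: Z sZ bZ nZ => [//|x1 [//|x2 [//|x3 [|//]]]] _ bX nZ.
have mem (x y z : g) : z \in <<[:: x; y]>>%VS ->
    exists a b, z = a *: x + b *: y.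
  rewrite span_cons span_seq1 => /memv_addP[u /vlineP[a ->] [v /vlineP[b ->] ->]].
  by exists a, b.
have /mem[al [be e12]] : lie x1 x2 \in <<[:: x1; x2]>>%VS.
  by apply: nZ; rewrite !inE eqxx ?orbT.
have /mem[p [q e23]] : lie x2 x3 \in <<[:: x2; x3]>>%VS.
  by apply: nZ; rewrite !inE eqxx ?orbT.
have /mem[r [s e31]] : lie x3 x1 \in <<[:: x3; x1]>>%VS.
  by apply: nZ; rewrite !inE eqxx ?orbT.
exists x1, x2, x3, al, be, p, q, r, s; split=> //.
- by rewrite e12 /lc3 /= scale0r addr0.
- by rewrite e23 /lc3 /= scale0r add0r.
- by rewrite e31 /lc3 /= scale0r addr0 addrC.
Qed.

(** The Jacobi sum of the basis vectors has coefficients [p * al - q * s], [r * p - s * be] and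
    [al * r - be * q]; all other terms cancel. *)
Lemma lie_table_jacobi g (x1 x2 x3 : g) al be p q r s :
  lie_table x1 x2 x3 (al, be, 0) (0, p, q) (s, 0, r) ->
  [/\ p * al = q * s, r * p = s * be & al * r = be * q].
Proof.
move=> T; have [bX e12 e23 e31] := T.
have := lie_jacobi x1 x2 x3; rewrite e12 e23 e31.
rewrite [X in lie X (lc3 _ _ _ (0, p, q))](lc3_1 x1 x2 x3).
rewrite [X in lie X (lc3 _ _ _ (s, 0, r))](lc3_2 x1 x2 x3).
rewrite [X in lie X (lc3 _ _ _ (al, be, 0))](lc3_3 x1 x2 x3).
rewrite !(lie_table_lc3 _ _ T) !lc3D [in RHS](lc3_0 x1 x2 x3).
move=> /(lc3_inj bX)[/= e1 e2 e3].
split; apply/eqP; rewrite -subr_eq0; apply/eqP.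
- by rewrite -[RHS]e1; ring.
- by rewrite -[RHS]e2; ring.
- by rewrite -[RHS]e3; ring.
Qed.

Lemma lie_table_rot g (x1 x2 x3 : g) a1 a2 a3 b1 b2 b3 c1 c2 c3 :
  lie_table x1 x2 x3 (a1, a2, a3) (b1, b2, b3) (c1, c2, c3) ->
  lie_table x2 x3 x1 (b2, b3, b1) (c2, c3, c1) (a2, a3, a1).
Proof.
have lc3_rot (u v w : g) a b c : lc3 u v w (a, b, c) = lc3 v w u (b, c, a).
  by rewrite /lc3 /= -addrA addrC.
case=> bX e12 e23 e31; split; try by rewrite -lc3_rot.
have P : perm_eq [:: x2; x3; x1] [:: x1; x2; x3].
  by rewrite -[X in perm_eq X]/(rot 1%N [:: x1; x2; x3]) perm_rot.
by rewrite (perm_basis _ P).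
Qed.

Lemma lie_table_abelian g (x1 x2 x3 : g) :
  lie_table x1 x2 x3 (0, 0, 0) (0, 0, 0) (0, 0, 0) -> lie_abelian g.
Proof.
case=> bX e12 e23 e31 x y; rewrite -(coord3K x bX) -(coord3K y bX) lie_lc3.
by rewrite e12 e23 e31 -!lc3_0 /lc3 !scaler0 !addr0.
Qed.

(** In the first form [x2] and [x3] span an abelian ideal on which ad [x1] is diagonal with
    eigenvalues [la] and [mu]; the sign arises because [x3, x1] is listed. In the second, dividing
    [x1], [x2], [x3] by [be], [q], [p] turns every nonzero coefficient into 1. *)
Definition normal_table g : Prop :=
  (exists x1 x2 x3 : g, exists la mu, (la, mu) != (0, 0) /\
    lie_table x1 x2 x3 (0, la, 0) (0, 0, 0) (0, 0, - mu)) \/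
  (exists x1 x2 x3 : g, exists be p q, [/\ be != 0, p != 0, q != 0 &
    lie_table x1 x2 x3 (q, be, 0) (0, p, q) (p, 0, be)]).

Lemma normal_table_step g (x1 x2 x3 : g) al be p q r s :
  lie_table x1 x2 x3 (al, be, 0) (0, p, q) (s, 0, r) -> (be, r) != (0, 0) ->
  normal_table g.
Proof.
move=> T; have [E1 E2 E3] := lie_table_jacobi T; rewrite xpair_eqE negb_and.
have [r0|r0] := eqVneq r 0; have [be0|be0] := eqVneq be 0 => // _.
- subst r; have q0 : q = 0.
    by apply/eqP; move/esym/eqP: E3; rewrite mulr0 mulf_eq0 (negPf be0).
  have s0 : s = 0.
    by apply/eqP; move/esym/eqP: E2; rewrite mul0r mulf_eq0 (negPf be0) orbF.
  subst q s; rewrite mul0r in E1.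
  (* The second vector is [x1, x2], an eigenvector of ad [x1] for [be]. The third lies in the kernel
     of ad [x1], its [x1]-coefficient being chosen so that the two commute. *)
  left; exists (lc3 x1 x2 x3 (1, 0, 0)), (lc3 x1 x2 x3 (al, be, 0)),
    (lc3 x1 x2 x3 (p, 0, be)), be, 0; split.
    by rewrite xpair_eqE (negPf be0).
  apply: (lie_table_change T); rewrite /det3 /vec3 /minors /=.
  + by rewrite !(mulr0, mul0r, subr0, addr0, mul1r) mulf_neq0.
  + by congr (_, _, _); ring.
  + by congr (_, _, _); ring: E1.
  + by congr (_, _, _); ring.
- subst be; have a0 : al = 0.
    by apply/eqP; move/eqP: E3; rewrite mul0r mulf_eq0 (negPf r0) orbF.
  have p0 : p = 0.
    by apply/eqP; move/eqP: E2; rewrite mulr0 mulf_eq0 (negPf r0).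
  subst al p; move/esym: E1; rewrite mul0r => E1.
  (* Mirror case: now [x3, x1] is the eigenvector, for [- r], and the second vector is the kernel
     vector commuting with it. *)
  left; exists (lc3 x1 x2 x3 (1, 0, 0)), (lc3 x1 x2 x3 (q, r, 0)),
    (lc3 x1 x2 x3 (s, 0, r)), 0, (- r); split.
    by rewrite xpair_eqE oppr_eq0 (negPf r0) andbF.
  apply: (lie_table_change T); rewrite /det3 /vec3 /minors /=.
  + by rewrite !(mulr0, mul0r, subr0, addr0, mul1r) mulf_neq0.
  + by congr (_, _, _); ring.
  + by congr (_, _, _); ring: E1.
  + by congr (_, _, _); ring.
have [E4|as0] := eqVneq (al * s * (be + r)) 0.
  (* The eigenvectors are [x1, x2] and [x3, x1]. By the Jacobi relations their bracket is
     [- (al * s * (be + r))] times [x1], so [E4] says that they commute. *)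
  left; exists (lc3 x1 x2 x3 (1, 0, 0)), (lc3 x1 x2 x3 (al, be, 0)),
    (lc3 x1 x2 x3 (s, 0, r)), be, (- r); split.
    by rewrite xpair_eqE (negPf be0).
  apply: (lie_table_change T); rewrite /det3 /vec3 /minors /=.
  + by rewrite !(mulr0, mul0r, subr0, addr0, mul1r) mulf_neq0.
  + by congr (_, _, _); ring.
  + have {}E4 : al * s * be = - (al * s * r).
      by apply/eqP; rewrite -addr_eq0 -mulrDr E4.
    by congr (_, _, _); [ring: E4 | ring: E2 | ring: E3].
  + by congr (_, _, _); ring.
have [[al0 s0] br0] : (al != 0 /\ s != 0) /\ be + r != 0.
  by move: as0; rewrite !mulf_eq0 !negb_or => /andP[/andP[]].
(* The Jacobi relations rewrite [al * s * (be + r) * (be - r)] as [be * r * (p * al - q * s)], which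
   is zero. *)
have br : be = r.
  apply/eqP; rewrite -subr_eq0; apply/eqP.
  apply: (mulfI as0); rewrite mulr0.
  have -> : al * s * (be + r) * (be - r) = al * be * (s * be) - s * r * (al * r).
    by ring.
  rewrite -E2 E3; have -> : al * be * (r * p) = be * r * (p * al) by ring.
  by rewrite E1; ring.
subst r; have {E3} E3 : al = q by apply: (mulfI be0); rewrite -E3 mulrC.
have {E2} E2 : p = s by apply: (mulfI be0); rewrite E2 mulrC.
subst al p; right; exists x1, x2, x3, be, s, q; split=> //.
Qed.

Lemma normal_table_exists g (Z : seq g) :
  \dim (@fullv _ g) = 3%N -> ~ lie_abelian g -> nijenhuis_eigenbasis Z ->
  normal_table g.
Proof.
move=> dim3 nab nZ.
have [x1 [x2 [x3 [al [be [p [q [r [s T]]]]]]]]] :=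
  table_nijenhuis_eigenbasis dim3 nZ.
(* Rotating the basis tests ad [x1], ad [x2] and ad [x3] in turn for a nonzero eigenvalue; if all
   three tests fail, all six coefficients vanish. *)
have [[be0 r0]|] := eqVneq (be, r) (0, 0); last exact: normal_table_step T.
have T2 := lie_table_rot T.
have [[q0 a0]|] := eqVneq (q, al) (0, 0); last exact: normal_table_step T2.
have T3 := lie_table_rot T2.
have [[s0 p0]|] := eqVneq (s, p) (0, 0); last exact: normal_table_step T3.
by case: nab; apply: (@lie_table_abelian _ x1 x2 x3); subst.
Qed.

End Tables.

(** * Structure constants of the models *)

Section Models.
Variable K : fieldType.

Lemma eta_basis : basis_of fullv [:: eta1 K; eta2 K; eta3 K].
Proof.
rewrite basisEdim dimvf /dim /= andbT; apply/subvP => x _.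
rewrite [x]row_sum_delta !big_ord_recl big_ord0.
rewrite !memvD ?mem0v // memvZ // memv_span // !inE.
- by apply/orP; left.
- by apply/orP; right; apply/orP; left; apply/eqP; congr delta_mx; apply/val_inj.
- by apply/orP; right; apply/orP; right; apply/eqP; congr delta_mx; apply/val_inj.
Qed.

Lemma b33_table : @lie_table _ (b33 K) (eta1 K) (eta2 K) (eta3 K)
  (0, 0, 1) (1, 0, 0) (0, 1, 0).
Proof.
have [//|//|//|e12 e23 e31] := @b33_lieE K (eta1 K) (eta2 K) (eta3 K).
split; rewrite ?e12 ?e23 ?e31 -?lc3_1 -?lc3_2 -?lc3_3 //; exact: eta_basis.
Qed.

Lemma b34_table : @lie_table _ (b34 K) (eta1 K) (eta2 K) (eta3 K)
  (0, 1, 0) (0, 0, 0) (0, 0, -1).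
Proof.
have [//|//|//|e12 e23 e31] := @b34_lieE K (eta1 K) (eta2 K) (eta3 K).
split; rewrite ?e12 ?e23 ?e31 -?lc3_1 -?lc3_2 -?lc3_0 //; first exact: eta_basis.
by rewrite /lc3 /= !scale0r !add0r scaleN1r.
Qed.

Lemma b36_table a : @lie_table _ (b36 a) (eta1 K) (eta2 K) (eta3 K)
  (0, a, 1) (0, 0, 0) (0, 1, - a).
Proof.
have [//|//|//|e12 e23 e31] := @b36_lieE K a (eta1 K) (eta2 K) (eta3 K).
split; rewrite ?e12 ?e23 ?e31 -?lc3_0 //; first exact: eta_basis.
  by rewrite /lc3 /= scale0r scale1r add0r.
by rewrite /lc3 /= scale0r scale1r add0r scaleNr.
Qed.

End Models.

(** * Eigenbases of the models, given a square root of -1 and 2 nonzero *)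

Section ModelTables.
Variables (K : fieldType) (i : K).
Hypotheses (i2 : i * i = -1) (two_neq0 : 2 != 0 :> K).

Let i_neq0 : i != 0.
Proof.
by apply/eqP => i0; move/eqP: i2; rewrite i0 mul0r eq_sym oppr_eq0 oner_eq0.
Qed.

Lemma b33_eigentable be p q : be != 0 -> p != 0 -> q != 0 ->
  exists y1 y2 y3 : b33 K, lie_table y1 y2 y3 (q, be, 0) (0, p, q) (p, 0, be).
Proof.
move=> be0 p0 q0; do 3!eexists.
(* The scaling works since [be * q] times z1 + z2 equals [q] times (be z1) plus [be] times (q z2),
   and similarly for the other two pairs. *)
apply: (lie_table_change (m1 := (be * i, 0, 0))
  (m2 := (- (q * i), q * i, - q)) (m3 := (- (p * i), - (p * i), - p)) (b33_table K)).
- have -> : det3 (be * i, 0, 0) (- (q * i), q * i, - q)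
      (- (p * i), - (p * i), - p) = 2 * (be * (p * q)).
    by rewrite /det3 /=; ring: i2.
  by rewrite !mulf_neq0.
- by rewrite /vec3 /minors /=; congr (_, _, _); ring: i2.
- by rewrite /vec3 /minors /=; congr (_, _, _); ring: i2.
- by rewrite /vec3 /minors /=; congr (_, _, _); ring: i2.
Qed.

Lemma b34_eigentable c : c != 0 ->
  exists y1 y2 y3 : b34 K, lie_table y1 y2 y3 (0, c, 0) (0, 0, 0) (0, 0, - c).
Proof.
move=> c0; do 3!eexists.
apply: (lie_table_change (m1 := (c, 0, 0)) (m2 := (0, 1, 0)) (m3 := (0, 0, 1))
  (b34_table K)).
- by have -> : det3 (c, 0, 0) (0, 1, 0) (0, 0, 1) = c by rewrite /det3 /=; ring.
- by rewrite /vec3 /minors /=; congr (_, _, _); ring.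
- by rewrite /vec3 /minors /=; congr (_, _, _); ring.
- by rewrite /vec3 /minors /=; congr (_, _, _); ring.
Qed.

(** The vectors eta2 + i eta3 and eta2 - i eta3 are eigenvectors of ad eta1 for [a - i] and [a + i];
    replacing eta1 by its multiple by [c] scales both eigenvalues. *)
Lemma b36_eigentable a c : c != 0 ->
  exists y1 y2 y3 : b36 a,
    lie_table y1 y2 y3 (0, c * (a - i), 0) (0, 0, 0) (0, 0, - (c * (a + i))).
Proof.
move=> c0; do 3!eexists.
apply: (lie_table_change (m1 := (c, 0, 0)) (m2 := (0, 1, i)) (m3 := (0, 1, - i))
  (b36_table a)).
- have -> : det3 (c, 0, 0) (0, 1, i) (0, 1, - i) = - (2 * (c * i)).
    by rewrite /det3 /=; ring.
  by rewrite oppr_eq0 !mulf_neq0.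
- by rewrite /vec3 /minors /=; congr (_, _, _); ring: i2.
- by rewrite /vec3 /minors /=; congr (_, _, _); ring: i2.
- by rewrite /vec3 /minors /=; congr (_, _, _); ring: i2.
Qed.

Lemma normal_table_isog (g : finLieAlgType K) : normal_table g ->
  lie_isog g (b33 K) \/ lie_isog g (b34 K) \/ exists a, lie_isog g (b36 a).
Proof.
case=> [[x1 [x2 [x3 [la [mu [n0 T]]]]]] | ]; last first.
  case=> x1 [x2 [x3 [be [p [q [be0 p0 q0 T]]]]]]; left.
  have [y1 [y2 [y3 T']]] := b33_eigentable be0 p0 q0.
  exact: lie_isog_table T T'.
right; have [e|ne] := eqVneq la mu.
  subst mu; left; have la0 : la != 0.
    by apply: contra_neq n0 => ->.
  have [y1 [y2 [y3 T']]] := b34_eigentable la0.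
  exact: lie_isog_table T T'.
(* [c] and the [a] below solve [c * (a - i) = la] and [c * (a + i) = mu]; distinct eigenvalues make
   [c] nonzero. *)
right; pose c := (mu - la) / (2 * i).
have c0 : c != 0.
  by rewrite mulf_neq0 ?invr_neq0 ?mulf_neq0 // subr_eq0 eq_sym.
pose a := (la + mu) / (2 * c); exists a.
have ca : c * a = (la + mu) / 2 by rewrite /a mulrCA invfM [c * _]mulrCA mulfV ?mulr1.
have ci : c * i = (mu - la) / 2 by rewrite /c; field; rewrite two_neq0 i_neq0.
have [y1 [y2 [y3]]] := b36_eigentable a c0.
have -> : c * (a - i) = la by rewrite mulrBr ca ci; field.
have -> : c * (a + i) = mu by rewrite mulrDr ca ci; field.
exact: lie_isog_table T.
Qed.

End ModelTables.

(* The characterisation over the complex numbers *)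
Close Scope ring_scope.

Theorem theorem3 (R : realType) (g : finLieAlgType R[i]) :
  \dim (@fullv _ g) = 3 -> ~ lie_abelian g ->
  ((exists Z : seq g, nijenhuis_eigenbasis Z) <->
   lie_isog g (b33 R[i]) \/ lie_isog g (b34 R[i]) \/
   exists a : R[i], lie_isog g (b36 a)).
Proof.
have i2 : ('i%C * 'i%C = -1 :> R[i])%R by rewrite -expr2 sqr_i.
have two_neq0 : (2 != 0 :> R[i])%R by rewrite Num.Theory.pnatr_eq0.
move=> dim3 nab; split=> [[Z nZ] | ].
  by refine (normal_table_isog i2 two_neq0 _); exact: normal_table_exists nZ.
have one0 : (1 != 0 :> R[i])%R := oner_neq0 _.
(* For the converse the free nonzero parameters are set to 1; each resulting table has the zero
   pattern of an eigenbasis, which is pulled back to [g]. *)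
case=> [isog | [isog | [a isog]]].
- have [y1 [y2 [y3 T]]] := b33_eigentable i2 two_neq0 one0 one0 one0.
  exact: nijenhuis_eigenbasis_isog isog (nijenhuis_eigenbasis_table T).
- have [y1 [y2 [y3 T]]] := b34_eigentable one0.
  exact: nijenhuis_eigenbasis_isog isog (nijenhuis_eigenbasis_table T).
- have [y1 [y2 [y3 T]]] := b36_eigentable i2 two_neq0 a one0.
  exact: nijenhuis_eigenbasis_isog isog (nijenhuis_eigenbasis_table T).
Qed.
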